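(* (1) Suppose that $\Phi$ is locally Lipschitz continuous in $S_1$ and that $x^*$ is a local minimizer of the constrained problem $\min\{\Phi(x): x\in S\}$. Then there exists $\lambda^*>0$ such that $x^*$ is a local minimizer of the penalty problem $\min_{x\in S_1}F_\lambda(x)$ whenever $\lambda\ge\lambda^*$. (2) If $\Phi$ is globally Lipschitz continuous in $S_1$, then there exists $\lambda^*>0$ such that any global minimizer of $\min\{\Phi(x):x\in S\}$ is a global minimizer of $\min_{x\in S_1}F_\lambda(x)$ whenever $\lambda\ge\lambda^*$; moreover, if $x^*$ is a global minimizer of $\min_{x\in S_1}F_\lambda(x)$ for some $\lambda>\lambda^*$, then $x^*$ is a global minimizer of $\min\{\Phi(x):x\in S\}$.
   Context: Standing setting. $\Phi:\mathbb{R}^n\to\mathbb{R}$ is a nonnegative continuous function. $A\in\mathbb{R}^{m\times n}$ has full row rank, $b\in\mathbb{R}^m$, $\sigma\ge 0$, $B\in\mathbb{R}^{\ell\times n}$, $h\in\mathbb{R}^\ell$, and $D$, $d$ are a matrix and a vector of compatible sizes. $S_1=\{x\in\mathbb{R}^n: Dx\le d\}$, $S_2=\{x\in\mathbb{R}^n:\|Ax-b\|\le\sigma,\ Bx\le h\}$, $S=S_1\cap S_2$ (inequalities componentwise, $\|\cdot\|$ Euclidean), and there exists $x_0\in S$ with $\|Ax_0-b\|<\sigma$. For a vector (or scalar) $a$, $a_+$ has entries $\max\{a_i,0\}$. For $\lambda>0$, $$F_\lambda(x)=\lambda\left[(\|Ax-b\|^2-\sigma^2)_+ +\|(Bx-h)_+\|_1\right]+\Phi(x).$$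 Local minimizers of each problem are understood relative to its feasible set ($S$ and $S_1$ respectively). *)

(* Defs.v *)
From mathcomp Require Import all_boot all_order all_algebra.
From mathcomp Require Import all_classical all_reals all_analysis.

Set Implicit Arguments.
Unset Strict Implicit.
Unset Printing Implicit Defensive.

Import Order.TTheory GRing.Theory Num.Theory.
Import numFieldNormedType.Exports.

Local Open Scope classical_set_scope.
Local Open Scope ring_scope.

(* The library norm `|v| on 'cV[R]_p is the max norm, hence a separate
   Euclidean norm; both induce the topology used by nbhs and continuous. *)
Definition enorm (R : realType) (p : nat) (v : 'cV[R]_p) : R :=
  Num.sqrt (\sum_(i < p) v i 0 ^+ 2).

Definition l1norm (R : realType) (p : nat) (v : 'cV[R]_p) : R :=
  \sum_(i < p) `|v i 0|.

Definition pos_part (R : realType) (t : R) : R := Num.max t 0.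

Definition vec_pos_part (R : realType) (p : nat) (v : 'cV[R]_p) : 'cV[R]_p :=
  map_mx (@pos_part R) v.

Definition vec_le (R : realType) (p : nat) (u v : 'cV[R]_p) : Prop :=
  forall i : 'I_p, u i 0 <= v i 0.

Definition lipschitz_in (R : realType) (n : nat)
    (f : 'cV[R]_n -> R) (X : set 'cV[R]_n) : Prop :=
  exists L : R, forall x y : 'cV[R]_n,
    X x -> X y -> `|f x - f y| <= L * enorm (x - y).

(* The neighbourhoods are relative to X: nothing is required of f outside X. *)
Definition locally_lipschitz_in (R : realType) (n : nat)
    (f : 'cV[R]_n -> R) (X : set 'cV[R]_n) : Prop :=
  forall x : 'cV[R]_n, X x ->
    exists2 U : set 'cV[R]_n, nbhs x U & lipschitz_in f (X `&` U).

Definition global_minimizer (R : realType) (n : nat)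
    (f : 'cV[R]_n -> R) (X : set 'cV[R]_n) (x : 'cV[R]_n) : Prop :=
  X x /\ forall y : 'cV[R]_n, X y -> f x <= f y.

Definition local_minimizer (R : realType) (n : nat)
    (f : 'cV[R]_n -> R) (X : set 'cV[R]_n) (x : 'cV[R]_n) : Prop :=
  X x /\ \forall y \near x, X y -> f x <= f y.

Definition S1 (R : realType) (n k : nat) (D : 'M[R]_(k, n)) (d : 'cV[R]_k) :
    set 'cV[R]_n :=
  [set x | vec_le (D *m x) d].

Definition S2 (R : realType) (n m l : nat)
    (A : 'M[R]_(m, n)) (b : 'cV[R]_m) (sigma : R)
    (B : 'M[R]_(l, n)) (h : 'cV[R]_l) : set 'cV[R]_n :=
  [set x | enorm (A *m x - b) <= sigma /\ vec_le (B *m x) h].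

Definition feasible_set (R : realType) (n m l k : nat)
    (A : 'M[R]_(m, n)) (b : 'cV[R]_m) (sigma : R)
    (B : 'M[R]_(l, n)) (h : 'cV[R]_l)
    (D : 'M[R]_(k, n)) (d : 'cV[R]_k) : set 'cV[R]_n :=
  S1 D d `&` S2 A b sigma B h.

Definition penalty_obj (R : realType) (n m l : nat) (Phi : 'cV[R]_n -> R)
    (A : 'M[R]_(m, n)) (b : 'cV[R]_m) (sigma : R)
    (B : 'M[R]_(l, n)) (h : 'cV[R]_l) (lambda : R) (x : 'cV[R]_n) : R :=
  lambda * (pos_part (enorm (A *m x - b) ^+ 2 - sigma ^+ 2)
            + l1norm (vec_pos_part (B *m x - h)))
  + Phi x.

(* Main.v *)
(* The penalty term v(x) controls the distance to the feasible set: there is C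
   with dist(x, S) <= C v(x) for every x in S1. Granting this, with L a Lipschitz
   constant of Phi, moving x to a feasible z changes Phi by at most L C v(x), so
   lambda >= L C makes leaving S unprofitable; locally, v is continuous and
   vanishes at the minimizer, so z stays in the neighbourhood where minimality
   and the Lipschitz bound hold.
   The error bound combines Hoffman's bound for the linear inequalities, obtained
   by Fourier-Motzkin elimination, with a convexity argument based on the Slater
   point for the norm constraint. *)
Require Import Defs.
From mathcomp Require Import all_boot all_order all_algebra.
From mathcomp Require Import all_classical all_reals all_analysis.
From mathcomp Require Import ring lra.
Import Order.TTheory GRing.Theory Num.Theory.
Import numFieldNormedType.Exports.
Local Open Scope classical_set_scope.
Local Open Scope ring_scope.

Set Implicit Arguments.
Unset Strict Implicit.
Unset Printing Implicit Defensive.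

(** * Euclidean and l1 norms of column vectors *)

Lemma enorm_ge0 (R : realType) (p : nat) (v : 'cV[R]_p) : 0 <= enorm v.
Proof. exact: sqrtr_ge0. Qed.

Lemma l1norm_ge0 (R : realType) (p : nat) (v : 'cV[R]_p) : 0 <= l1norm v.
Proof. exact: sumr_ge0. Qed.

Lemma enorm_sqr (R : realType) (p : nat) (v : 'cV[R]_p) :
  enorm v ^+ 2 = \sum_(i < p) v i 0 ^+ 2.
Proof. by rewrite sqr_sqrtr// sumr_ge0// => i _; rewrite sqr_ge0. Qed.

Lemma enormZ (R : realType) (p : nat) (t : R) (v : 'cV[R]_p) :
  enorm (t *: v) = `|t| * enorm v.
Proof.
rewrite /enorm -sqrtr_sqr -sqrtrM ?sqr_ge0// mulr_sumr.
by under eq_bigr do rewrite mxE exprMn.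
Qed.

Lemma enorm_coord (R : realType) (p : nat) (v : 'cV[R]_p) (i : 'I_p) :
  `|v i 0| <= enorm v.
Proof.
rewrite -(ler_pXn2r (n := 2)) ?nnegrE ?enorm_ge0// enorm_sqr real_normK ?num_real//.
by rewrite (bigD1 i)//= lerDl sumr_ge0// => j _; rewrite sqr_ge0.
Qed.

(** Expanding the squares of [enorm v * u i 0 - enorm u * v i 0] gives the inequality multiplied by
    [enorm u * enorm v]. If this factor is zero, one of the vectors vanishes. *)
Lemma Cauchy_Schwarz_sum (R : realType) (p : nat) (u v : 'cV[R]_p) :
  \sum_(i < p) u i 0 * v i 0 <= enorm u * enorm v.
Proof.
have key : (enorm u * enorm v) * \sum_(i < p) u i 0 * v i 0 <= (enorm u * enorm v) ^+ 2.
  have : 0 <= \sum_(i < p) (enorm v * u i 0 - enorm u * v i 0) ^+ 2.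
    by apply: sumr_ge0 => i _; rewrite sqr_ge0.
  have -> : \sum_(i < p) (enorm v * u i 0 - enorm u * v i 0) ^+ 2 =
     enorm v ^+ 2 * (\sum_(i < p) u i 0 ^+ 2) +
     enorm u ^+ 2 * (\sum_(i < p) v i 0 ^+ 2) -
     2 * (enorm u * enorm v) * \sum_(i < p) u i 0 * v i 0.
    rewrite !mulr_sumr -big_split -sumrB /=.
    by apply: eq_bigr => i _; ring.
  rewrite -!enorm_sqr; nra.
have := mulr_ge0 (enorm_ge0 u) (enorm_ge0 v).
rewrite le_eqVlt => /predU1P[uv0|uv_gt0]; last first.
  by move: key; rewrite expr2 ler_pM2l.
rewrite -uv0 big1// => i _.
move: uv0 (enorm_coord u i) (enorm_coord v i) => /esym/eqP.
by rewrite mulf_eq0 => /orP[]/eqP-> => [+ _|_]; rewrite normr_le0 => /eqP->;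
  rewrite ?mul0r ?mulr0.
Qed.

Lemma enormD (R : realType) (p : nat) (u v : 'cV[R]_p) :
  enorm (u + v) <= enorm u + enorm v.
Proof.
rewrite -(ler_pXn2r (n := 2)) ?nnegrE ?addr_ge0 ?enorm_ge0// enorm_sqr.
have -> : \sum_(i < p) (u + v) i 0 ^+ 2 =
    enorm u ^+ 2 + enorm v ^+ 2 + 2 * \sum_(i < p) u i 0 * v i 0.
  rewrite !enorm_sqr mulr_sumr -!big_split /=.
  by apply: eq_bigr => i _; rewrite mxE; ring.
have := Cauchy_Schwarz_sum u v; nra.
Qed.

Lemma enorm_l1norm (R : realType) (p : nat) (v : 'cV[R]_p) :
  enorm v <= l1norm v.
Proof.
rewrite -(ler_pXn2r (n := 2)) ?nnegrE ?enorm_ge0 ?l1norm_ge0// enorm_sqr.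
rewrite [leRHS]expr2 {1}/l1norm mulr_suml; apply: ler_sum => i _.
rewrite -real_normK ?num_real// expr2 ler_wpM2l//.
by rewrite /l1norm (bigD1 i)//= lerDl sumr_ge0.
Qed.

Lemma l1normD (R : realType) (p : nat) (u v : 'cV[R]_p) :
  l1norm (u + v) <= l1norm u + l1norm v.
Proof.
by rewrite -big_split; apply: ler_sum => i _; rewrite mxE ler_normD.
Qed.

Lemma l1normZ (R : realType) (p : nat) (t : R) (v : 'cV[R]_p) :
  l1norm (t *: v) = `|t| * l1norm v.
Proof.
by rewrite mulr_sumr; apply: eq_bigr => i _; rewrite mxE normrM.
Qed.

Lemma l1norm_delta (R : realType) (p : nat) (j : 'I_p) :
  l1norm (delta_mx j 0 : 'cV[R]_p) = 1.
Proof.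
rewrite /l1norm (bigD1 j)//= mxE !eqxx normr1 big1 ?addr0// => i ij.
by rewrite mxE (negbTE ij) normr0.
Qed.

(** * Finite systems of linear inequalities and Hoffman's bound *)

Lemma seq_ubound (R : realType) (T : eqType) (s : seq T) (F : T -> R) :
  exists2 M : R, 0 <= M & forall c, c \in s -> F c <= M.
Proof.
exists (\big[Num.max/0]_(c <- s) F c).
  by elim/big_rec: _ => // c x _ x0; rewrite le_max x0 orbT.
by move=> c cs; exact: le_bigmax_seq.
Qed.

(** Supplies the value of an eliminated variable: the largest lower bound or, if there is none, a
    number below all upper bounds. *)
Lemma seq_separation (R : realType) (lo hi : seq R) :
  (forall a b, a \in lo -> b \in hi -> a <= b) ->
  exists t, (forall a, a \in lo -> a <= t) /\ (forall b, b \in hi -> t <= b).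
Proof.
case: lo => [_|a0 lo ab].
  exists (- \big[Num.max/0]_(b <- hi) (- b)); split=> // b bhi.
  by rewrite lerNl; exact: le_bigmax_seq.
exists (\big[Num.max/a0]_(a <- lo) a); split=> [a|b bhi].
  rewrite inE => /predU1P[->|alo]; last exact: le_bigmax_seq.
  by elim/big_rec: _ => // c x _ x0; rewrite le_max x0 orbT.
rewrite big_seq; apply: (big_ind (fun x => x <= b)) => [|x y xb yb|a alo].
- by rewrite ab ?inE ?eqxx.
- by rewrite ge_max xb.
- by rewrite ab ?inE ?alo ?orbT.
Qed.

(** The pair [c] stands for the inequality [c.1 *m x <= c.2]; positive values measure its
    violation. *)
Definition slack (R : realType) (n : nat) (c : 'rV[R]_n * R) (x : 'cV[R]_n) : R :=
  (c.1 *m x) 0 0 - c.2.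

Lemma slackDZ (R : realType) (n : nat) (c : 'rV[R]_n * R) (x y : 'cV[R]_n) (t : R) :
  slack c (x + t *: y) = slack c x + t * (c.1 *m y) 0 0.
Proof. by rewrite /slack mulmxDr -scalemxAr !mxE; ring. Qed.

Lemma mulmx_bound (R : realType) (m n : nat) (M : 'M[R]_(m, n)) :
  exists2 K : R, 0 <= K & forall x : 'cV[R]_n, l1norm (M *m x) <= K * l1norm x.
Proof.
exists (\sum_i \sum_j `|M i j|) => [|x]; first by rewrite !sumr_ge0// => i _; rewrite sumr_ge0.
rewrite mulr_suml; apply: ler_sum => i _; rewrite mxE.
rewrite (le_trans (ler_norm_sum _ _ _))// mulr_suml; apply: ler_sum => j _.
rewrite normrM ler_wpM2l//.
by rewrite /l1norm (bigD1 j)//= lerDl sumr_ge0.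
Qed.

Lemma functionals_bound (R : realType) (n : nat) (s : seq ('rV[R]_n * R)) :
  exists2 N : R, 0 <= N &
    forall c x, c \in s -> (c.1 *m x) 0 0 <= N * l1norm (x : 'cV[R]_n).
Proof.
elim: s => [|c s [N N0 IH]]; first by exists 0.
have [M M0 cM] := mulmx_bound c.1.
exists (N + M) => [|c' x]; first exact: addr_ge0.
have x0 := l1norm_ge0 x.
rewrite inE mulrDl => /predU1P[->|c's].
  rewrite (le_trans (ler_norm _))// (le_trans (enorm_coord _ _))//.
  by rewrite (le_trans (enorm_l1norm _))// (le_trans (cM x))// lerDr mulr_ge0.
by rewrite (le_trans (IH _ x c's))// lerDl mulr_ge0.
Qed.

(* For u.1 0 e > 0 > v.1 0 e this is a positive combination of u and v in which
   the variable e cancels. *)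
Definition fm_comb (R : realType) (n : nat) (e : 'I_n) (u v : 'rV[R]_n * R) :
    'rV[R]_n * R :=
  (u.1 0 e *: v.1 - v.1 0 e *: u.1, u.1 0 e * v.2 - v.1 0 e * u.2).

(** One Fourier-Motzkin step: [x] solves the new system exactly when some change of its coordinate
    [e] solves [s]. *)
Definition fm_elim (R : realType) (n : nat) (e : 'I_n) (s : seq ('rV[R]_n * R)) :
    seq ('rV[R]_n * R) :=
  [seq c : 'rV[R]_n * R <- s | c.1 0 e == 0] ++
  [seq fm_comb e u v | u <- [seq c : 'rV[R]_n * R <- s | 0 < c.1 0 e], v <- [seq c : 'rV[R]_n * R <- s | c.1 0 e < 0]].

Lemma slack_fm_comb (R : realType) (n : nat) (e : 'I_n) (u v : 'rV[R]_n * R) x :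
  slack (fm_comb e u v) x = u.1 0 e * slack v x - v.1 0 e * slack u x.
Proof.
by rewrite /slack /= mulmxBl -!scalemxAl !mxE; ring.
Qed.

Lemma fm_elimP (R : realType) (n : nat) (e : 'I_n) (s : seq ('rV[R]_n * R)) c :
  c \in fm_elim e s ->
  (c \in s /\ c.1 0 e = 0) \/
  exists u v, [/\ u \in s, v \in s, 0 < u.1 0 e, v.1 0 e < 0 & c = fm_comb e u v].
Proof.
rewrite mem_cat => /orP[|].
  by rewrite mem_filter => /andP[/eqP ? ?]; left.
case/allpairsP => -[u v] /= []; rewrite !mem_filter => /andP[u0 us] /andP[v0 vs] ->.
by right; exists u, v.
Qed.

(* The induction eliminates the coordinate k: a point feasible for the eliminated
   system is lifted by a value t of that coordinate lying between all lower and
   all upper bounds; adding - (W * K) and W * K to these bounds keeps t small. *)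
Lemma hoffman_coord (R : realType) (n k : nat) (s : seq ('rV[R]_n * R)) :
  (k <= n)%N ->
  (forall c (i : 'I_n), c \in s -> (k <= i)%N -> c.1 0 i = 0) ->
  (exists x, forall c, c \in s -> slack c x <= 0) ->
  exists2 C : R, 0 <= C &
    forall x (w : R), 0 <= w -> (forall c, c \in s -> slack c x <= w) ->
      exists2 y, (forall c, c \in s -> slack c y <= 0) & l1norm (x - y) <= C * w.
Proof.
elim: k s => [|k IH] s kn supp [x0 x0s].
  (* With all rows zero the inequalities do not depend on the point, so solvability makes them hold
     everywhere. *)
  exists 0 => // x w w0 _; exists x => [c cs|]; last first.
    by rewrite subrr mul0r /l1norm big1// => i _; rewrite mxE normr0.
  have c0 : c.1 = 0.
    by apply/rowP => i; rewrite supp// mxE.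
  by have := x0s c cs; rewrite /slack c0 !mul0mx.
pose e := Ordinal kn.
have [|||C C0 HC] := IH (fm_elim e s); first exact: ltnW.
- move=> c i /fm_elimP[[cs ce] ki|[u [v [us vs _ _ ->]]] ki] /=.
    have [->//|ie] := eqVneq i e; apply: supp => //.
    by rewrite ltn_neqAle ki andbT eq_sym.
  rewrite !mxE; have [->|ie] := eqVneq i e; first by ring.
  have ki' : (k < i)%N by rewrite ltn_neqAle ki andbT eq_sym.
  by rewrite (supp u i)// (supp v i)// !mulr0 subrr.
- exists x0 => c /fm_elimP[[cs _]|[u [v [us vs u0 v0 ->]]]]; first exact: x0s.
  rewrite slack_fm_comb; have := x0s _ us; have := x0s _ vs; nra.
have [M M0 sM] := @seq_ubound R _ s (fun c : 'rV[R]_n * R => `|c.1 0 e|).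
have [N N0 sN] := functionals_bound s.
have [K K0 sK] := @seq_ubound R _ s (fun c : 'rV[R]_n * R => `|c.1 0 e|^-1).
(* A combined inequality is violated at [x] by at most [(M + M) * w], a kept one by at most [w];
   hence [Q * w] will bound the distance from [x] to [y']. *)
pose Q := C * (1 + M + M).
exists (Q + (1 + N * Q) * K) => [|x w w0 xw].
  by rewrite !(addr_ge0, mulr_ge0).
have [||y' y's xy'] := HC x ((1 + M + M) * w); first by rewrite !(mulr_ge0, addr_ge0).
  move=> c /fm_elimP[[cs _]|[u [v [us vs u0 v0 ->]]]].
    by rewrite (le_trans (xw _ cs))// ler_peMl//; lra.
  rewrite slack_fm_comb.
  have := sM _ us; have := sM _ vs; rewrite (gtr0_norm u0) (ltr0_norm v0).
  have := xw _ us; have := xw _ vs; nra.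
rewrite mulrA -/Q in xy'.
(* Bounds every slack at [y']: [w] at [x], plus [N] times the distance moved. *)
pose W := (1 + N * Q) * w.
have Q0 : 0 <= Q by rewrite !(addr_ge0, mulr_ge0).
have W0 : 0 <= W by rewrite !(addr_ge0, mulr_ge0).
have y'W c : c \in s -> slack c y' <= W.
  move=> cs; have -> : y' = x + (-1) *: (x - y').
    by rewrite scaleN1r opprB addrC subrK.
  rewrite slackDZ.
  have -> : -1 * (c.1 *m (x - y')) 0 0 = (c.1 *m ((-1) *: (x - y'))) 0 0.
    by rewrite -scalemxAr !mxE.
  rewrite /W mulrDl mul1r lerD ?xw// (le_trans (sN _ _ cs))// -mulrA ler_wpM2l//.
  by rewrite l1normZ normrN normr1 mul1r.
have [|t [tlo thi]] := @seq_separation R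
  (- (W * K) :: [seq slack c y' / - c.1 0 e | c : 'rV[R]_n * R <- s & c.1 0 e < 0])
  (W * K :: [seq - slack c y' / c.1 0 e | c : 'rV[R]_n * R <- s & 0 < c.1 0 e]).
  have WK0 : 0 <= W * K by rewrite mulr_ge0.
  (* Hence no lower bound exceeds [W * K] and no upper bound falls below [- (W * K)]. *)
  have inv_bound c : c \in s -> slack c y' / `|c.1 0 e| <= W * K.
    move=> cs; rewrite (le_trans (ler_wpM2r _ (y'W _ cs))) ?invr_ge0//.
    by rewrite ler_wpM2l// sK.
  move=> a b; rewrite !inE => /predU1P[->|/mapP[v + ->]] /predU1P[->|/mapP[u + ->]].
  - lra.
  - rewrite mem_filter => /andP[u0 us].
    by have := inv_bound _ us; rewrite gtr0_norm// mulNr lerN2.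
  - rewrite mem_filter => /andP[v0 vs].
    by have := inv_bound _ vs; rewrite ltr0_norm//.
  - rewrite !mem_filter => /andP[v0 vs] /andP[u0 us].
    (* With denominators cleared, this is the inequality [fm_comb e u v] at [y']. *)
    rewrite ler_pdivrMr ?oppr_gt0// mulrAC ler_pdivlMr//.
    have : slack (fm_comb e u v) y' <= 0.
      apply: y's; rewrite mem_cat; apply/orP; right.
      by apply/allpairsP; exists (u, v); rewrite !mem_filter u0 us v0 vs.
    rewrite slack_fm_comb; lra.
have De (c : 'rV[R]_n * R) : (c.1 *m (delta_mx e 0 : 'cV_n)) 0 0 = c.1 0 e by rewrite -colE mxE.
exists (y' + t *: delta_mx e 0) => [c cs|].
  rewrite slackDZ De; case: (ltgtP (c.1 0 e) 0) => [c0|c0|c0].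
  - have : slack c y' / - c.1 0 e <= t.
      apply: tlo; rewrite inE; apply/orP; right; apply/mapP; exists c => //.
      by rewrite mem_filter c0.
    by rewrite ler_pdivrMr ?oppr_gt0//; lra.
  - have : t <= - slack c y' / c.1 0 e.
      apply: thi; rewrite inE; apply/orP; right; apply/mapP; exists c => //.
      by rewrite mem_filter c0.
    by rewrite ler_pdivlMr//; lra.
  - rewrite c0 mulr0 addr0; apply: y's.
    by rewrite mem_cat mem_filter c0 eqxx cs.
have tWK : `|t| <= W * K.
  by rewrite ler_norml tlo ?thi// inE eqxx.
rewrite opprD addrA (le_trans (l1normD _ _))// mulrDl lerD//.
rewrite -scaleNr l1normZ normrN l1norm_delta mulr1 (le_trans tWK)//.
by rewrite /W mulrAC.
Qed.

Lemma hoffman (R : realType) (n : nat) (s : seq ('rV[R]_n * R)) :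
  (exists x, forall c, c \in s -> slack c x <= 0) ->
  exists2 C : R, 0 <= C &
    forall x (w : R), 0 <= w -> (forall c, c \in s -> slack c x <= w) ->
      exists2 y, (forall c, c \in s -> slack c y <= 0) & l1norm (x - y) <= C * w.
Proof.
(* With [k = n] all coordinates get eliminated. *)
apply: (@hoffman_coord R n n) => // c i _.
by rewrite leqNgt ltn_ord.
Qed.

(** * The constraint violation and its error bound *)

(** As lists, the inequalities of several matrices can be concatenated into one system. *)
Definition rows_system (R : realType) (p n : nat) (M : 'M[R]_(p, n)) (g : 'cV[R]_p) :
    seq ('rV[R]_n * R) :=
  [seq (row i M, g i 0) | i <- enum 'I_p].

Lemma rows_systemP (R : realType) (p n : nat) (M : 'M[R]_(p, n)) (g : 'cV[R]_p) x w :
  (forall c, c \in rows_system M g -> slack c x <= w) <->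
  (forall i, (M *m x) i 0 - g i 0 <= w).
Proof.
have slackE i : slack (row i M, g i 0) x = (M *m x) i 0 - g i 0.
  by rewrite /slack -row_mul mxE.
split=> [H i|H c /mapP[i _ ->]]; last by rewrite slackE.
by rewrite -slackE; apply: H; apply/mapP; exists i; rewrite ?mem_enum.
Qed.

Lemma vec_leP (R : realType) (p n : nat) (M : 'M[R]_(p, n)) (g : 'cV[R]_p) x :
  (forall c, c \in rows_system M g -> slack c x <= 0) <-> vec_le (M *m x) g.
Proof.
by split=> [/rows_systemP H i|H]; [|apply/rows_systemP => i];
  have := H i; rewrite subr_le0.
Qed.

(** The factor of [lambda] in [penalty_obj]. *)
Definition violation (R : realType) (n m l : nat)
    (A : 'M[R]_(m, n)) (b : 'cV[R]_m) (sigma : R)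
    (B : 'M[R]_(l, n)) (h : 'cV[R]_l) (x : 'cV[R]_n) : R :=
  pos_part (enorm (A *m x - b) ^+ 2 - sigma ^+ 2)
  + l1norm (vec_pos_part (B *m x - h)).

Lemma pos_part_ge0 (R : realType) (t : R) : 0 <= pos_part t.
Proof. by rewrite le_max lexx orbT. Qed.

Lemma pos_part_ge (R : realType) (t : R) : t <= pos_part t.
Proof. by rewrite le_max lexx. Qed.

Lemma pos_part_coord_le (R : realType) (p : nat) (v : 'cV[R]_p) i :
  v i 0 <= l1norm (vec_pos_part v).
Proof.
rewrite (le_trans (pos_part_ge _))// /l1norm (bigD1 i)//= mxE.
by rewrite (le_trans (ler_norm _))// lerDl sumr_ge0.
Qed.

Lemma violation_ge0 (R : realType) (n m l : nat)
    (A : 'M[R]_(m, n)) b sigma (B : 'M[R]_(l, n)) h x :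
  0 <= violation A b sigma B h x.
Proof. by rewrite addr_ge0 ?pos_part_ge0 ?l1norm_ge0. Qed.

Lemma violation_S2 (R : realType) (n m l : nat)
    (A : 'M[R]_(m, n)) b sigma (B : 'M[R]_(l, n)) h x :
  0 <= sigma -> violation A b sigma B h x = 0 <-> S2 A b sigma B h x.
Proof.
move=> s0; split=> [|[Ax Bx]].
  move/eqP; rewrite paddr_eq0 ?pos_part_ge0 ?l1norm_ge0// => /andP[/eqP v0 /eqP w0].
  split=> [|i].
    rewrite -(ler_pXn2r (n := 2)) ?nnegrE ?enorm_ge0// -subr_le0 -v0.
    exact: pos_part_ge.
  by have := pos_part_coord_le (B *m x - h) i; rewrite w0 !mxE subr_le0.
rewrite /violation /pos_part max_r ?add0r; last first.
  by rewrite subr_le0 ler_pXn2r ?nnegrE ?enorm_ge0.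
rewrite /l1norm big1// => i _; rewrite mxE /pos_part max_r ?normr0//.
by have := Bx i; rewrite !mxE subr_le0.
Qed.

(* A point of S1 is first moved, by Hoffman's bound, to a point y satisfying all
   linear constraints, then along the segment towards some x1 with A x1 = A x0.
   Choosing x1 close to y (Hoffman again) instead of x1 = x0 is what makes the
   constant uniform on an unbounded feasible set. *)
Lemma error_bound (R : realType) (n m l k : nat)
    (A : 'M[R]_(m, n)) (b : 'cV[R]_m) (sigma : R)
    (B : 'M[R]_(l, n)) (h : 'cV[R]_l)
    (D : 'M[R]_(k, n)) (d : 'cV[R]_k) (x0 : 'cV[R]_n) :
  feasible_set A b sigma B h D d x0 -> enorm (A *m x0 - b) < sigma ->
  exists2 C : R, 0 <= C & forall x, S1 D d x ->
    exists2 z, feasible_set A b sigma B h D d z &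
      enorm (x - z) <= C * violation A b sigma B h x.
Proof.
move=> [Dx0 [_ Bx0]]; set s0 := enorm (A *m x0 - b) => s0sigma.
have s0_ge0 : 0 <= s0 by exact: enorm_ge0.
have sigma_gt0 : 0 < sigma by exact: le_lt_trans s0sigma.
pose P := rows_system D d ++ rows_system B h.
have PE x : (forall c, c \in P -> slack c x <= 0) <->
    vec_le (D *m x) d /\ vec_le (B *m x) h.
  split=> [H|[/vec_leP HD /vec_leP HB] c]; last first.
    by rewrite mem_cat => /orP[/HD|/HB].
  by split; apply/vec_leP => c cs; apply: H; rewrite mem_cat cs ?orbT.
have [|C1 C10 H1] := @hoffman R n P; first by exists x0; apply/PE.
(* The equation [A *m x = A *m x0] as two opposite inequalities. *)
pose E := rows_system A (A *m x0) ++ rows_system (- A) (- (A *m x0)).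
have [|C2 C20 H2] := @hoffman R n (P ++ E).
  exists x0 => c; rewrite mem_cat => /orP[|]; first by apply: (PE x0).2 => //.
  by rewrite mem_cat => /orP[]; move: c; apply/vec_leP => i; rewrite // mulNmx.
have [K K0 AK] := mulmx_bound A.
(* The value at [r = sigma] of [(r + s0) / (r - s0)], which does not increase for [r > s0]. *)
pose G := (sigma + s0) / (sigma - s0).
have G0 : 0 <= G by rewrite divr_ge0; lra.
have si0 : 0 <= sigma^-1 by rewrite invr_ge0 ltW.
have C30 : 0 <= C2 * G * (sigma^-1 + K * C1).
  by rewrite mulr_ge0// ?addr_ge0// mulr_ge0.
exists (C1 + C2 * G * (sigma^-1 + K * C1)) => [|x Dx]; first exact: addr_ge0.
rewrite /violation.
set v := pos_part _; set w := l1norm (vec_pos_part _).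
have v0 : 0 <= v by exact: pos_part_ge0.
have w0 : 0 <= w by exact: l1norm_ge0.
have C1w : 0 <= C1 * w by rewrite mulr_ge0.
have [||y yP xy] := H1 x w => //.
  move=> c; rewrite mem_cat => /orP[cD|].
    by rewrite (le_trans _ w0)//; move: c cD; apply/vec_leP.
  move: c; apply/rows_systemP => i.
  by have := pos_part_coord_le (B *m x - h) i; rewrite !mxE.
have [Dy By] := (PE y).1 yP.
set r := enorm (A *m y - b).
have rx : r - sigma <= v * sigma^-1 + K * (C1 * w).
  have r1 : r <= enorm (A *m x - b) + K * (C1 * w).
    have -> : r = enorm ((A *m x - b) + (-1) *: (A *m (x - y))).
      by congr enorm; rewrite mulmxBr; apply/colP => i; rewrite !mxE; ring.
    rewrite (le_trans (enormD _ _))// lerD2l enormZ normrN normr1 mul1r.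
    by rewrite (le_trans (enorm_l1norm _))// (le_trans (AK _))// ler_wpM2l.
  (* For [a = enorm (A *m x - b)] above [sigma], [(a - sigma) * sigma <= (a - sigma) * (a + sigma)
     <= v]. *)
  have : enorm (A *m x - b) - sigma <= v * sigma^-1.
    have := enorm_ge0 (A *m x - b).
    have : enorm (A *m x - b) ^+ 2 - sigma ^+ 2 <= v by exact: pos_part_ge.
    rewrite ler_pdivlMr//; case: (lerP (enorm (A *m x - b)) sigma); nra.
  lra.
have [r_le|r_gt] := lerP r sigma.
  exists y => //; rewrite (le_trans (enorm_l1norm _))// (le_trans xy)//.
  by rewrite ler_pM ?lerDl ?lerDr.
(* By the triangle inequality through [b], [y] violates [E] by at most [r + s0]. *)
have [||x1 x1P yx1] := H2 y (r + s0); first by lra.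
  move=> c; rewrite mem_cat => /orP[/yP cy|]; first by lra.
  have Ay i : `|(A *m y) i 0 - (A *m x0) i 0| <= r + s0.
    have -> : (A *m y) i 0 - (A *m x0) i 0 =
        ((A *m y - b) + (-1) *: (A *m x0 - b)) i 0 by rewrite !mxE; ring.
    rewrite (le_trans (enorm_coord _ _))// (le_trans (enormD _ _))//.
    by rewrite enormZ normrN normr1 mul1r.
  rewrite mem_cat => /orP[]; move: c; apply/rows_systemP => i.
    by rewrite (le_trans (ler_norm _)).
  rewrite mulNmx [X in X - _]mxE [X in _ - X]mxE opprK addrC.
  by rewrite (le_trans (ler_norm _))// distrC.
have /PE[Dx1 Bx1] : forall c, c \in P -> slack c x1 <= 0.
  by move=> c cP; apply: x1P; rewrite mem_cat cP.
have Ax1 : A *m x1 = A *m x0.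
  have /vec_leP leA : forall c, c \in rows_system A (A *m x0) -> slack c x1 <= 0.
    by move=> c cA; apply: x1P; rewrite !mem_cat cA ?orbT.
  have /vec_leP geA :
      forall c, c \in rows_system (- A) (- (A *m x0)) -> slack c x1 <= 0.
    by move=> c cA; apply: x1P; rewrite !mem_cat cA ?orbT.
  apply/colP => i; apply/eqP; rewrite eq_le leA /=.
  by have := geA i; rewrite mulNmx [leLHS]mxE [leRHS]mxE lerN2.
(* Solves [(1 - t) * r + t * s0 = sigma], so convexity of the norm puts [z] in the ball. *)
pose t := (r - sigma) / (r - s0).
have t0 : 0 <= t by rewrite divr_ge0; lra.
have t1 : t <= 1 by rewrite ler_pdivrMr; lra.
pose z := y + t *: (x1 - y).
have segment p (M : 'M[R]_(p, n)) g : vec_le (M *m y) g -> vec_le (M *m x1) g ->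
    vec_le (M *m z) g.
  move=> yg x1g i; rewrite mulmxDr -scalemxAr mulmxBr.
  by have := yg i; have := x1g i; rewrite !mxE; nra.
exists z; first (split; [exact: segment|split; [|exact: segment]]).
  have -> : A *m z - b = (1 - t) *: (A *m y - b) + t *: (A *m x0 - b).
    rewrite mulmxDr -scalemxAr mulmxBr Ax1.
    by apply/colP => i; rewrite !mxE; ring.
  rewrite (le_trans (enormD _ _))// !enormZ !ger0_norm ?subr_ge0//.
  rewrite -/r -/s0.
  have : t * (r - s0) = r - sigma by rewrite divfK//; lra.
  lra.
have trs : t * (r + s0) <= G * (r - sigma).
  rewrite /t mulrAC ler_pdivrMr; last lra.
  have -> : G * (r - sigma) * (r - s0) =
      (sigma + s0) * (r - sigma) * (r - s0) / (sigma - s0) by rewrite /G; ring.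
  rewrite ler_pdivlMr; last lra.
  (* The two sides differ by twice this quantity. *)
  have : 0 <= (r - sigma) ^+ 2 * s0 by rewrite mulr_ge0// sqr_ge0.
  lra.
have -> : x - z = (x - y) + t *: (y - x1).
  by apply/colP => i; rewrite !mxE; ring.
rewrite (le_trans (enorm_l1norm _))// (le_trans (l1normD _ _))//.
rewrite l1normZ (ger0_norm t0).
have : t * l1norm (y - x1) <= C2 * (G * (v * sigma^-1 + K * (C1 * w))).
  rewrite (le_trans (ler_wpM2l t0 yx1))// mulrCA ler_wpM2l//.
  by rewrite (le_trans trs)// ler_wpM2l.
(* These are the surplus terms in the expansion of the constant times [v + w]. *)
have : 0 <= C1 * v by rewrite mulr_ge0.
have : 0 <= C2 * G * sigma^-1 * w by do 3 rewrite mulr_ge0//.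
have : 0 <= C2 * G * K * C1 * v by do 4 rewrite mulr_ge0//.
lra.
Qed.

(** * Continuity of the violation *)

Lemma continuous_sum_ord (R : realType) (T : topologicalType) (p : nat)
    (f : 'I_p -> T -> R) :
  (forall i, continuous (f i)) -> continuous (fun x => \sum_(i < p) f i x).
Proof.
move=> fc x; apply: cvg_big => [|i _]; first exact: add_continuous.
exact: fc.
Qed.

Lemma mulmx_coord_continuous (R : realType) (p n : nat) (M : 'M[R]_(p, n)) g i :
  continuous (fun x : 'cV[R]_n => (M *m x - g) i 0).
Proof.
have -> : (fun x : 'cV[R]_n => (M *m x - g) i 0) =
    (fun x => \sum_j M i j * x j 0 - g i 0).
  by apply/funext => x; rewrite !mxE.
have Mc j : continuous (fun x : 'cV[R]_n => M i j * x j 0).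
  move=> x; apply: (@continuousM _ _ (fun=> M i j) (fun v : 'cV[R]_n => v j 0)).
    exact: cst_continuous.
  exact: coord_continuous.
move=> x; apply: (@continuousB _ _ _ (fun v : 'cV[R]_n => \sum_j M i j * v j 0) (fun=> g i 0)).
  exact: continuous_sum_ord.
exact: cst_continuous.
Qed.

Lemma violation_continuous (R : realType) (n m l : nat)
    (A : 'M[R]_(m, n)) b sigma (B : 'M[R]_(l, n)) h :
  continuous (violation A b sigma B h).
Proof.
have pos_cont (f : 'cV[R]_n -> R) : continuous f -> continuous (fun x => pos_part (f x)).
  by move=> fc x; apply: (@continuous_max _ _ f (fun=> 0)); [exact: fc|exact: cst_continuous].
have sqr_norm_cont : continuous (fun x => enorm (A *m x - b) ^+ 2).
  have -> : (fun x => enorm (A *m x - b) ^+ 2) =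
      (fun x => \sum_i (A *m x - b) i 0 ^+ 2).
    by apply/funext => x; rewrite enorm_sqr.
  apply: continuous_sum_ord => i x.
  by apply: (@continuousM _ _ (fun x => (A *m x - b) i 0) (fun x => (A *m x - b) i 0));
    exact: mulmx_coord_continuous.
have ball_cont : continuous (fun x => enorm (A *m x - b) ^+ 2 - sigma ^+ 2).
  move=> x; apply: (@continuousB _ _ _ (fun x => enorm (A *m x - b) ^+ 2) (fun=> sigma ^+ 2)).
    exact: sqr_norm_cont.
  exact: cst_continuous.
have rows_cont : continuous (fun x => l1norm (vec_pos_part (B *m x - h))).
  apply: continuous_sum_ord => i.
  have -> : (fun x => `|vec_pos_part (B *m x - h) i 0|) =
      (fun x => pos_part ((B *m x - h) i 0)).
    by apply/funext => x; rewrite mxE ger0_norm// pos_part_ge0.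
  by apply: pos_cont; exact: mulmx_coord_continuous.
move=> x; apply: (@continuousD _ _ _
  (fun x => pos_part (enorm (A *m x - b) ^+ 2 - sigma ^+ 2))
  (fun x => l1norm (vec_pos_part (B *m x - h)))).
  exact: pos_cont.
exact: rows_cont.
Qed.

(** Links the Euclidean error bound to neighbourhoods, which are balls of the max norm. *)
Lemma mx_norm_enorm (R : realType) (p : nat) (v : 'cV[R]_p) : `|v| <= enorm v.
Proof.
rewrite [leLHS]mx_normrE; apply: bigmax_le => [|[i j] _]; first exact: enorm_ge0.
by rewrite (ord1 j) enorm_coord.
Qed.

(** * Exactness of the penalty, local and global *)

Unset Implicit Arguments.

Theorem theorem3p1 (R : realType) (n m l k : nat)
    (Phi : 'cV[R]_n -> R)
    (A : 'M[R]_(m, n)) (b : 'cV[R]_m) (sigma : R)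
    (B : 'M[R]_(l, n)) (h : 'cV[R]_l)
    (D : 'M[R]_(k, n)) (d : 'cV[R]_k)
    (Phi_ge0 : forall x : 'cV[R]_n, 0 <= Phi x)
    (Phi_cont : continuous Phi)
    (A_full_row_rank : row_free A)
    (sigma_ge0 : 0 <= sigma)
    (slater : exists2 x0 : 'cV[R]_n,
       feasible_set A b sigma B h D d x0 & enorm (A *m x0 - b) < sigma) :
  (locally_lipschitz_in Phi (S1 D d) ->
   forall xs : 'cV[R]_n,
     local_minimizer Phi (feasible_set A b sigma B h D d) xs ->
     exists2 lambda_s : R, 0 < lambda_s &
       forall lambda : R, lambda_s <= lambda ->
         local_minimizer (penalty_obj Phi A b sigma B h lambda) (S1 D d) xs)
  /\
  (lipschitz_in Phi (S1 D d) ->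
   exists2 lambda_s : R, 0 < lambda_s &
     (forall xs : 'cV[R]_n,
        global_minimizer Phi (feasible_set A b sigma B h D d) xs ->
        forall lambda : R, lambda_s <= lambda ->
          global_minimizer (penalty_obj Phi A b sigma B h lambda) (S1 D d) xs)
     /\
     (forall (lambda : R) (xs : 'cV[R]_n), lambda_s < lambda ->
        global_minimizer (penalty_obj Phi A b sigma B h lambda) (S1 D d) xs ->
        global_minimizer Phi (feasible_set A b sigma B h D d) xs)).

Proof.
case: slater => x0 Sx0 Ax0.
have [C C0 HC] := error_bound Sx0 Ax0.
pose viol := violation A b sigma B h.
have viol0 x : feasible_set A b sigma B h D d x -> viol x = 0.
  by move=> [_ /violation_S2]; apply.
have penaltyE lambda x :
    penalty_obj Phi A b sigma B h lambda x = lambda * viol x + Phi x by [].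
have penalty_feas lambda x : feasible_set A b sigma B h D d x ->
    penalty_obj Phi A b sigma B h lambda x = Phi x.
  by move=> Sx; rewrite penaltyE viol0// mulr0 add0r.
(* An infeasible x may be moved into the feasible set at a Phi-cost of at most
   (|L| C) * viol x, which a larger lambda pays for. *)
have project L x z : `|Phi x - Phi z| <= L * enorm (x - z) ->
    enorm (x - z) <= C * viol x -> Phi z <= `|L| * C * viol x + Phi x.
  move=> fxz xzC; rewrite -lerBlDr (le_trans (ler_norm _))// distrC (le_trans fxz)//.
  rewrite (le_trans (ler_wpM2r (enorm_ge0 _) (ler_norm L)))//.
  by rewrite -mulrA ler_wpM2l.
have viol_ge0 x : 0 <= viol x by exact: violation_ge0.
have pen_le (L lambda : R) x : `|L| * C + 1 <= lambda ->
    `|L| * C * viol x + Phi x <= penalty_obj Phi A b sigma B h lambda x.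
  by move=> Ll; rewrite penaltyE lerD2r ler_wpM2r// (le_trans _ Ll)// lerDl.
(* The summand 1 keeps the threshold positive when [L] or [C] is zero; the absolute value is there
   because [L] may be negative. *)
have lam_gt0 (L : R) : 0 < `|L| * C + 1 by rewrite ltr_wpDl// mulr_ge0.
split=> [lip xs [Sxs xs_min]|[L lip]].
  have [U nU [L lipU]] := lip xs Sxs.1.
  exists (`|L| * C + 1) => // lambda Ll; split; first exact: Sxs.1.
  have [e /= e0 eUV] := (nbhs_normP _ _).1 (filterI nU xs_min).
  (* With [x] within [e / 2] of [xs] and [z] within [e / 2] of [x], both lie in the ball of radius
     [e] where the Lipschitz bound and minimality hold. *)
  have viol_small : \forall x \near xs, C * viol x < e / 2.
    have : {for xs, continuous (fun x => C * viol x)}.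
      apply: (@continuousM _ _ (fun=> C) viol); first exact: cst_continuous.
      exact: violation_continuous.
    by move/cvgr_lt; apply; rewrite /= viol0// mulr0 divr_gt0.
  have xs_near : \forall x \near xs, `|xs - x| < e / 2.
    by apply/nbhs_normP; exists (e / 2) => //=; exact: divr_gt0.
  near=> x => Dx; rewrite penalty_feas//.
  have [z Sz xz] := HC x Dx.
  have xsx : `|xs - x| < e / 2.
    by near: x.
  have Cx : C * viol x < e / 2 by near: x.
  have [Ux _] : (U `&` [set y | feasible_set A b sigma B h D d y -> Phi xs <= Phi y]) x.
    by apply: eUV => /=; rewrite (lt_trans xsx)// ltr_pdivrMr// ltr_pMr// ltr1n.
  have [Uz xsz] :
      (U `&` [set y | feasible_set A b sigma B h D d y -> Phi xs <= Phi y]) z.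
    apply: eUV => /=; rewrite -(subrKA x) (le_lt_trans (ler_normD _ _))//.
    rewrite [ltRHS](splitr e) ltrD// (le_lt_trans (mx_norm_enorm _))//.
    exact: le_lt_trans Cx.
  rewrite (le_trans (xsz Sz))// (le_trans _ (pen_le _ _ _ Ll))// (project _ _ z)//.
  by apply: lipU => //; split => //; exact: Sz.1.
exists (`|L| * C + 1) => //; split.
  move=> xs [Sxs xs_min] lambda Ll; split=> [|x Dx]; first exact: Sxs.1.
  have [z Sz xz] := HC x Dx.
  rewrite penalty_feas// (le_trans (xs_min z Sz))// (le_trans _ (pen_le _ _ _ Ll))//.
  by apply: project => //; apply: lip => //; exact: Sz.1.
move=> lambda xs Ll [Dxs xs_min].
have [z Sz xz] := HC xs Dxs.
(* Comparing [xs] with [z] gives [(lambda - |L| * C) * viol xs <= 0] with a positive first factor,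
   so the violation vanishes. *)
have Sxs : feasible_set A b sigma B h D d xs.
  split=> //; apply/violation_S2 => //; apply/eqP; rewrite eq_le viol_ge0 andbT.
  have := xs_min z Sz.1; rewrite (penalty_feas lambda z Sz) penaltyE.
  have : Phi z <= `|L| * C * viol xs + Phi xs.
    by apply: project => //; apply: lip => //; exact: Sz.1.
  rewrite -/(viol xs); have := viol_ge0 xs; nra.
split=> // y Sy; rewrite -(penalty_feas lambda xs Sxs) -(penalty_feas lambda y Sy).
exact: xs_min Sy.1.
Unshelve. all: by end_near.
Qed.
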